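(* Let $k\in\mathbb{Z}$, let $\nu\in\mathbb{R}$ with $\nu\neq 0$, and let $\lambda\in\mathbb{C}$ with $\lambda\neq 1$. For all integers $n\ge 0$ and $r\ge 0$, as polynomials in $x$, $$HB_{n}^{(\nu,k)}(x)=\frac{1}{(1-\lambda)^{r}}\sum_{m=0}^{n}\binom{n}{m}\left\{\sum_{l=0}^{r}\binom{r}{l}(-\lambda)^{r-l}HB_{n-m}^{(\nu,k)}(l)\right\}H_{m}^{(r)}(x|\lambda).$$
   Context: For $k\in\mathbb{Z}$ the polylogarithm is the power series $\mathrm{Li}_k(x)=\sum_{n=1}^{\infty}\frac{x^n}{n^k}$. All generating functions below are formal power series in $t$. For $\lambda\in\mathbb{C}$, $\lambda\ne 1$, and an integer $r\ge 0$, the Frobenius-Euler polynomials $H_n^{(r)}(x|\lambda)$ of order $r$ are defined by $$\left(\frac{1-\lambda}{e^t-\lambda}\right)^r e^{xt}=\sum_{n=0}^{\infty}H_n^{(r)}(x|\lambda)\frac{t^n}{n!}.$$ For real $\nu\neq 0$, the Hermite and poly-Bernoulli mixed-type polynomials $HB_n^{(\nu,k)}(x)$ are defined by $$e^{-\frac{\nu t^2}{2}}\,\frac{\mathrm{Li}_k(1-e^{-t})}{1-e^{-t}}\,e^{xt}=\sum_{n=0}^{\infty}HB_n^{(\nu,k)}(x)\frac{t^n}{n!}.$$ Here $HB_{n-m}^{(\nu,k)}(l)$ is the value of this polynomial at $x=l$, and $0^0=1$. *)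

(* Defs.v *)
From HB Require Import structures.
From mathcomp Require Import all_boot all_order all_algebra.
From mathcomp Require Import boolp reals.
From mathcomp Require Import complex.
From mathcomp Require Import zify.

Set Implicit Arguments.
Unset Strict Implicit.
Unset Printing Implicit Defensive.

Import Order.TTheory GRing.Theory Num.Theory.

Local Open Scope ring_scope.

(* [f n] is the coefficient of t ^ n in [f]. *)
Record fps (A : Type) := FPS { fps_coef :> nat -> A }.

Lemma fpsP (A : Type) (f g : fps A) : f =1 g <-> f = g.
Proof. by split=> [|-> //]; case: f g => [f] [g] /= /funext ->. Qed.

HB.instance Definition _ (A : Type) := gen_eqMixin (fps A).
HB.instance Definition _ (A : Type) := gen_choiceMixin (fps A).

Section Zmodule.
Variable A : zmodType.
Implicit Types f g h : fps A.

Definition fps_zero : fps A := FPS (fun=> 0).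
Definition fps_opp f := FPS (fun n => - f n).
Definition fps_add f g := FPS (fun n => f n + g n).

Fact fps_addA : associative fps_add.
Proof. by move=> f g h; apply/fpsP => n /=; rewrite addrA. Qed.
Fact fps_addC : commutative fps_add.
Proof. by move=> f g; apply/fpsP => n /=; rewrite addrC. Qed.
Fact fps_add0 : left_id fps_zero fps_add.
Proof. by move=> f; apply/fpsP => n /=; rewrite add0r. Qed.
Fact fps_addN : left_inverse fps_zero fps_opp fps_add.
Proof. by move=> f; apply/fpsP => n /=; rewrite addNr. Qed.

HB.instance Definition _ :=
  GRing.isZmodule.Build (fps A) fps_addA fps_addC fps_add0 fps_addN.

Lemma fps0E n : (0 : fps A) n = 0. Proof. by []. Qed.
Lemma fpsDE f g n : (f + g) n = f n + g n. Proof. by []. Qed.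
Lemma fpsNE f n : (- f) n = - f n. Proof. by []. Qed.
Lemma fpsBE f g n : (f - g) n = f n - g n. Proof. by []. Qed.

Lemma fps_sumE (I : Type) (r : seq I) (P : pred I) (F : I -> fps A) n :
  (\sum_(i <- r | P i) F i) n = \sum_(i <- r | P i) F i n.
Proof. by elim/big_rec2: _ => // i a f _ <-. Qed.

End Zmodule.

Definition fpsC (A : zmodType) (a : A) : fps A :=
  FPS (fun n => if n == 0%N then a else 0).

Notation "a %:S" := (fpsC a) (at level 2, left associativity, format "a %:S")
  : ring_scope.

Section Ring.
Variable A : comNzRingType.
Implicit Types f g h : fps A.

Definition fps_mul f g := FPS (fun n => \sum_(i < n.+1) f i * g (n - i)%N).

Let trunc N f : {poly A} := \poly_(i < N) f i.

Let mul_trunc N f g n : (n < N)%N -> fps_mul f g n = (trunc N f * trunc N g)`_n.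
Proof.
move=> nN; rewrite coefM /=; apply: eq_bigr => i _.
rewrite !coef_poly (leq_ltn_trans (leq_subr _ _) nN).
by rewrite (leq_ltn_trans _ nN) // -ltnS.
Qed.

Let truncM N f g n : (n < N)%N ->
  (trunc N (fps_mul f g))`_n = (trunc N f * trunc N g)`_n.
Proof. by move=> nN; rewrite coef_poly nN (mul_trunc _ _ nN). Qed.

Fact fps_mulC : commutative fps_mul.
Proof.
by move=> f g; apply/fpsP => n; rewrite !(mul_trunc _ _ (ltnSn n)) mulrC.
Qed.

Fact fps_mulA : associative fps_mul.
Proof.
move=> f g h; apply/fpsP => n; rewrite !(mul_trunc _ _ (ltnSn n)).
transitivity ((trunc n.+1 f * trunc n.+1 g * trunc n.+1 h)`_n).
  rewrite -mulrA !coefM; apply: eq_bigr => i _.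
  by rewrite truncM // ltnS leq_subr.
by rewrite !coefM; apply: eq_bigr => i _; rewrite truncM.
Qed.

Fact fps_mul1 : left_id (1%:S) fps_mul.
Proof.
move=> f; apply/fpsP => n /=; rewrite big_ord_recl /= mul1r subn0 big1 ?addr0 //.
by move=> i _; rewrite /= mul0r.
Qed.

Fact fps_mulDl : left_distributive fps_mul +%R.
Proof.
move=> f g h; apply/fpsP => n /=; rewrite -big_split /=.
by apply: eq_bigr => i _; rewrite mulrDl.
Qed.

Fact fps_one_neq0 : (1%:S : fps A) != 0.
Proof. by apply/eqP => /fpsP/(_ 0%N)/eqP; rewrite /= (negbTE (oner_neq0 A)). Qed.

HB.instance Definition _ := GRing.Zmodule_isComNzRing.Build (fps A)
  fps_mulA fps_mulC fps_mul1 fps_mulDl fps_one_neq0.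

Lemma fps1E n : (1 : fps A) n = (n == 0%N)%:R.
Proof. by rewrite /=; case: eqP. Qed.

Lemma fpsME f g n : (f * g) n = \sum_(i < n.+1) f i * g (n - i)%N.
Proof. by []. Qed.

Lemma fpsCM a f n : (a%:S * f) n = a * f n.
Proof.
rewrite fpsME big_ord_recl /= subn0 big1 ?addr0 // => i _.
by rewrite /= mul0r.
Qed.

Definition fpsX : fps A := FPS (fun n => (n == 1%N)%:R).

Lemma fpsXM f n : (fpsX * f) n = if n is m.+1 then f m else 0.
Proof.
case: n => [|n]; first by rewrite fpsME big_ord1 /= mul0r.
rewrite fpsME 2!big_ord_recl /= mul0r add0r mul1r subSS subn0 big1 ?addr0 //.
by move=> i _; rewrite /= mul0r.
Qed.

Lemma fps_exp_coef0 g j n : g 0%N = 0 -> (n < j)%N -> (g ^+ j) n = 0.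
Proof.
move=> g0; elim: j n => // j IH n nj; rewrite exprS fpsME big1 // => -[i ile] _ /=.
case: i ile => [|i] ile; first by rewrite g0 mul0r.
by rewrite IH ?mulr0 //; lia.
Qed.

(* f (g (t)). Meaningful only if [g 0 = 0]: then [g ^+ j] contributes to the
   coefficient of t ^ n for j <= n only. *)
Definition fps_comp f g : fps A :=
  FPS (fun n => \sum_(j < n.+1) f j * (g ^+ j) n).

(* f / t, for f with zero constant term. *)
Definition fps_shift f : fps A := FPS (fun n => f n.+1).

Lemma fps_shiftK f : f 0%N = 0 -> fpsX * fps_shift f = f.
Proof. by move=> f0; apply/fpsP => -[|n]; rewrite fpsXM. Qed.

End Ring.

Arguments fpsX {A}.

Section UnitRing.
Variable A : comUnitRingType.
Implicit Types f g h : fps A.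

Definition fps_unit : {pred fps A} := fun f => f 0%N \is a GRing.unit.

(* With a = f 0 a unit, f = a (1 - h) for some h with h 0 = 0, and
   f^-1 = a^-1 (1 + h + h ^ 2 + ...). *)
Definition fps_inv f : fps A :=
  if f 0%N \is a GRing.unit then
    ((f 0%N)^-1)%:S * fps_comp (FPS (fun=> 1)) (1 - ((f 0%N)^-1)%:S * f)
  else f.

Let geomE h n N : h 0%N = 0 -> (n < N)%N ->
  fps_comp (FPS (fun=> 1)) h n = (\sum_(j < N) h ^+ j) n.
Proof.
move=> h0 nN; rewrite fps_sumE /= (eq_bigr _ (fun _ _ => mul1r _)).
rewrite -!(big_mkord xpredT (fun j => (h ^+ j) n)).
rewrite [RHS](big_cat_nat (n := n.+1)) //= [X in _ + X]big_nat_cond.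
rewrite [X in _ + X]big1 ?addr0 // => j /andP[/andP[nj _] _].
exact: fps_exp_coef0.
Qed.

Let geomK h : h 0%N = 0 -> (1 - h) * fps_comp (FPS (fun=> 1)) h = 1.
Proof.
move=> h0; apply/fpsP => n.
transitivity (((1 - h) * \sum_(j < n.+1) h ^+ j) n).
  rewrite !fpsME; apply: eq_bigr => i _.
  by rewrite (geomE h0 (N := n.+1)) // ltnS leq_subr.
rewrite -opprB mulNr -subrX1 opprB fpsBE.
by rewrite (fps_exp_coef0 h0 (ltnSn n)) subr0.
Qed.

Fact fps_mulVx : {in fps_unit, left_inverse 1 fps_inv *%R}.
Proof.
move=> f; rewrite unfold_in /fps_unit /fps_inv => uf; rewrite uf.
set a := f 0%N in uf *; rewrite mulrAC.
have {1}-> : a^-1%:S * f = 1 - (1 - a^-1%:S * f) by rewrite opprB addrC subrK.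
by rewrite geomK // fpsBE fpsCM mulVr ?subrr.
Qed.

Fact fps_unitPl f g : g * f = 1 -> fps_unit f.
Proof.
move=> /fpsP/(_ 0%N); rewrite fpsME big_ord1 /= => gf1.
by apply/unitrPr; exists (g 0%N); rewrite mulrC.
Qed.

Fact fps_inv_out : {in [predC fps_unit], fps_inv =1 id}.
Proof. by move=> f; rewrite inE unfold_in /fps_unit /fps_inv => /negbTE ->. Qed.

HB.instance Definition _ := GRing.ComNzRing_hasMulInverse.Build (fps A)
  fps_mulVx fps_unitPl fps_inv_out.

Lemma fps_unitE f : (f \is a GRing.unit) = (f 0%N \is a GRing.unit).
Proof. by []. Qed.

(* The quotient f / g of two series with zero constant term, where g has order
   exactly 1; such a g is not a unit of [fps A]. See [fps_quotK]. *)
Definition fps_quot f g : fps A := fps_shift f / fps_shift g.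

Lemma fps_quotK f g : f 0%N = 0 -> g 0%N = 0 -> g 1%N \is a GRing.unit ->
  fps_quot f g * g = f.
Proof.
move=> f0 g0 ug; rewrite -{2}(fps_shiftK g0) mulrCA divrK ?fps_unitE //.
exact: fps_shiftK.
Qed.

Definition exp_series : fps A := FPS (fun n => n`!%:R^-1).

(* Meaningful only if [g 0 = 0]. *)
Definition fps_exp g : fps A := fps_comp exp_series g.

Definition polylog (k : int) : fps A :=
  FPS (fun n => if n == 0%N then 0 else (n%:R ^ k)^-1).

Definition egf_coef f (n : nat) : A := n`!%:R * f n.

End UnitRing.

Arguments exp_series {A}.

Section Polynomials.
Variable R : realType.
Local Notation C := R[i].
Local Notation t := (fpsX : fps {poly C}).

Definition frobenius_euler_gf (r : nat) (lambda : C) : fps {poly C} :=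
  ((1 - lambda)%:P%:S / (fps_exp t - lambda%:P%:S)) ^+ r * fps_exp ('X%:S * t).

Lemma frobenius_euler_den_unit (lambda : C) : lambda != 1 ->
  fps_exp t - lambda%:P%:S \is a GRing.unit.
Proof.
move=> lambda_neq1; rewrite fps_unitE fpsBE /= big_ord1 /= fact0 invr1 mul1r.
have neq0 : 1 - lambda != 0 by rewrite subr_eq0 eq_sym.
by rewrite -polyCB poly_unitE size_polyC coefC /= unitfE neq0.
Qed.

Definition frobenius_euler (r : nat) (lambda : C) (n : nat) : {poly C} :=
  egf_coef (frobenius_euler_gf r lambda) n.

Definition poly_bernoulli_quot (k : int) : fps {poly C} :=
  fps_quot (fps_comp (polylog _ k) (1 - fps_exp (- t))) (1 - fps_exp (- t)).

Lemma poly_bernoulli_quotE k :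
  poly_bernoulli_quot k * (1 - fps_exp (- t)) =
    fps_comp (polylog _ k) (1 - fps_exp (- t)).
Proof.
apply: fps_quotK.
- by rewrite /= big_ord1 mul0r.
- by rewrite fpsBE /= big_ord1 /= fact0 invr1 mul1r subrr.
- rewrite fpsBE /= big_ord_recl big_ord1 expr1 expr0 fps1E /= fact0 invr1.
  by rewrite mulr0 mul1r add0r sub0r opprK unitr1.
Qed.

Definition hermite_poly_bernoulli_gf (nu : R) (k : int) : fps {poly C} :=
  fps_exp ((- (nu%:C%C / 2))%:P%:S * t ^+ 2) * poly_bernoulli_quot k *
    fps_exp ('X%:S * t).

Definition hermite_poly_bernoulli (nu : R) (k : int) (n : nat) : {poly C} :=
  egf_coef (hermite_poly_bernoulli_gf nu k) n.

End Polynomials.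

(* Main.v *)
Require Import Defs.
From HB Require Import structures.
From mathcomp Require Import all_boot all_order all_algebra.
From mathcomp Require Import reals complex.

Set Implicit Arguments.
Unset Strict Implicit.
Unset Printing Implicit Defensive.

Import GRing.Theory.

Local Open Scope ring_scope.

(** Write the generating function of the Hermite poly-Bernoulli polynomials as
    G(x) = P e^(x t), where the series P does not involve x. By the binomial
    theorem,
      sum_l binom(r, l) (-lambda)^(r - l) G(l)
        = P sum_l binom(r, l) (-lambda)^(r - l) (e^t)^l = P (e^t - lambda)^r,
    and multiplying by the Frobenius-Euler generating function
    ((1 - lambda) / (e^t - lambda))^r e^(x t) cancels (e^t - lambda)^r, leaving
    (1 - lambda)^r G(x) ([hermite_poly_bernoulli_gf_expand]). The theorem
    compares the coefficients of t^n / n!: a product of exponential generating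
    functions has the binomial convolution as coefficients ([egf_coefM]).

    The values of G at x = l are obtained by substituting the constant l for x
    in all coefficients of G. This is a ring morphism of power series
    ([fps_map]), so it can be pushed through products, compositions and quotients; it fixes P
    since P is built from rational numbers and nu alone. *)

(** * Constant series and coefficientwise images *)

Section Constants.
Variable A : comNzRingType.

Fact fpsC_is_zmod_morphism : zmod_morphism (@fpsC A).
Proof.
by move=> a b; apply/fpsP => n /=; case: (n == 0%N); rewrite ?subr0.
Qed.

Fact fpsC_is_monoid_morphism : monoid_morphism (@fpsC A).
Proof.
split=> // a b; apply/fpsP => n; rewrite fpsCM /=.
by case: (n == 0%N); rewrite ?mulr0.
Qed.

HB.instance Definition _ := GRing.isZmodMorphism.Build A (fps A)
  (@fpsC A) fpsC_is_zmod_morphism.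
HB.instance Definition _ := GRing.isMonoidMorphism.Build A (fps A)
  (@fpsC A) fpsC_is_monoid_morphism.

End Constants.

Definition fps_map (A B : Type) (f : A -> B) (g : fps A) : fps B :=
  FPS (fun n => f (g n)).

Section MapRing.
Variables (A B : comNzRingType) (f : {rmorphism A -> B}).

Fact fps_map_is_zmod_morphism : zmod_morphism (fps_map f).
Proof. by move=> g h; apply/fpsP => n /=; rewrite rmorphB. Qed.

Fact fps_map_is_monoid_morphism : monoid_morphism (fps_map f).
Proof.
split=> [|g h]; apply/fpsP => n /=.
  by case: (n == 0%N); rewrite ?rmorph1 ?rmorph0.
by rewrite rmorph_sum; apply: eq_bigr => i _; rewrite rmorphM.
Qed.

HB.instance Definition _ := GRing.isZmodMorphism.Build (fps A) (fps B)
  (fps_map f) fps_map_is_zmod_morphism.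
HB.instance Definition _ := GRing.isMonoidMorphism.Build (fps A) (fps B)
  (fps_map f) fps_map_is_monoid_morphism.

Lemma fps_mapC a : fps_map f a%:S = (f a)%:S.
Proof. by apply/fpsP => n /=; case: (n == 0%N); rewrite ?rmorph0. Qed.

Lemma fps_mapX : fps_map f fpsX = fpsX.
Proof. by apply/fpsP => n /=; rewrite rmorph_nat. Qed.

Lemma fps_map_comp g h :
  fps_map f (fps_comp g h) = fps_comp (fps_map f g) (fps_map f h).
Proof.
apply/fpsP => n /=; rewrite rmorph_sum; apply: eq_bigr => j _.
by rewrite rmorphM -rmorphXn.
Qed.

End MapRing.

(** The exponential and polylogarithm series have the intended coefficients
    only over rings in which the positive integers are invertible. *)
Definition nat_units (A : unitRingType) : Prop :=
  forall n, (n.+1)%:R \is a @GRing.unit A.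

Lemma nat_units_fact (A : unitRingType) n :
  nat_units A -> n`!%:R \is a @GRing.unit A.
Proof. by move=> uA; have := fact_gt0 n; case: n`! => // m _; apply: uA. Qed.

Lemma nat_units_poly (F : numFieldType) : nat_units {poly F}.
Proof.
move=> n; rewrite -polyC_natr poly_unitE size_polyC coefC /= unitfE.
by rewrite Num.Theory.pnatr_eq0.
Qed.

Section MapUnitRing.
Variables (A B : comUnitRingType) (f : {rmorphism A -> B}).
Hypothesis uA : nat_units A.

Lemma fps_map_exp g : fps_map f (fps_exp g) = fps_exp (fps_map f g).
Proof.
rewrite /fps_exp fps_map_comp; congr fps_comp; apply/fpsP => n /=.
by rewrite rmorphV ?nat_units_fact // rmorph_nat.
Qed.

Lemma fps_map_polylog k : fps_map f (polylog A k) = polylog B k.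
Proof.
apply/fpsP => -[|n] /=; first by rewrite rmorph0.
by rewrite rmorphV ?unitrXz // rmorphXz // rmorph_nat.
Qed.

Lemma fps_map_quot (g h : fps A) : h 1%N \is a GRing.unit ->
  fps_map f (fps_quot g h) = fps_quot (fps_map f g) (fps_map f h).
Proof. by move=> uh; rewrite /fps_quot rmorphM rmorphV ?fps_unitE. Qed.

(** The morphism passes through the quotient because the coefficient of t in
    1 - e^(-t) is 1, so that dividing out t leaves an invertible series. *)
Lemma fps_map_polylog_quot k :
  fps_map f (fps_quot (fps_comp (polylog A k) (1 - fps_exp (- fpsX)))
                      (1 - fps_exp (- fpsX))) =
    fps_quot (fps_comp (polylog B k) (1 - fps_exp (- fpsX)))
             (1 - fps_exp (- fpsX)).
Proof.
have mapE : fps_map f (1 - fps_exp (- fpsX)) = 1 - fps_exp (- fpsX).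
  by rewrite rmorphB rmorph1 /= fps_map_exp rmorphN /= fps_mapX.
rewrite fps_map_quot; first by rewrite fps_map_comp fps_map_polylog mapE.
rewrite fpsBE /= big_ord_recl big_ord1 expr1 expr0 fps1E /= fact0 invr1.
by rewrite mulr0 mul1r add0r sub0r opprK unitr1.
Qed.

(** The Hermite poly-Bernoulli generating function over an arbitrary ring:
    apart from the scalars [a] and [b] it is built from rational numbers, so a
    morphism acts on these two alone. *)
Lemma fps_map_polylog_gf k (a b : A) :
  fps_map f (fps_exp (a%:S * fpsX ^+ 2) *
             fps_quot (fps_comp (polylog A k) (1 - fps_exp (- fpsX)))
                      (1 - fps_exp (- fpsX)) *
             fps_exp (b%:S * fpsX)) =
    fps_exp ((f a)%:S * fpsX ^+ 2) *
    fps_quot (fps_comp (polylog B k) (1 - fps_exp (- fpsX)))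
             (1 - fps_exp (- fpsX)) *
    fps_exp ((f b)%:S * fpsX).
Proof.
have mapM g h : fps_map f (g * h) = fps_map f g * fps_map f h.
  exact: rmorphM.
have mapX2 : fps_map f (fpsX ^+ 2) = fpsX ^+ 2 by rewrite rmorphXn /= fps_mapX.
rewrite mapM mapM fps_map_polylog_quot; congr (_ * _ * _).
  by rewrite fps_map_exp mapM fps_mapC mapX2.
by rewrite fps_map_exp mapM fps_mapC fps_mapX.
Qed.

End MapUnitRing.

(** * Exponentials of linear series *)

Section ExpLinear.
Variable A : comUnitRingType.
Hypothesis uA : nat_units A.

(** A power of a monomial is a monomial, so a single term of the composition
    survives. *)
Lemma coef_fps_exp_linear (a : A) n :
  (fps_exp (a%:S * fpsX)) n = n`!%:R^-1 * a ^+ n.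
Proof.
have coefXn j m : ((a%:S * fpsX) ^+ j) m = (m == j)%:R * a ^+ j.
  elim: j m => [|j IH] m; first by rewrite !expr0 mulr1 fps1E.
  rewrite exprS -mulrA fpsCM fpsXM.
  case: m => [|m]; first by rewrite mulr0 mul0r.
  by rewrite IH eqSS mulrCA exprS.
rewrite /= big_ord_recr /= coefXn eqxx mul1r big1 ?add0r // => j _.
by rewrite coefXn gtn_eqF ?mul0r ?mulr0.
Qed.

Lemma fps_exp_linearD (a b : A) :
  fps_exp ((a + b)%:S * fpsX) = fps_exp (a%:S * fpsX) * fps_exp (b%:S * fpsX).
Proof.
apply/fpsP => n; rewrite coef_fps_exp_linear fpsME addrC exprDn mulr_sumr.
apply: eq_bigr => i _; have le_in : (i <= n)%N by rewrite -ltnS.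
have uf m : m`!%:R \is a @GRing.unit A by exact: nat_units_fact.
rewrite !coef_fps_exp_linear mulrACA [a ^+ _ * _]mulrC.
rewrite -[X in _ * X = _]mulr_natl [LHS]mulrA.
congr (_ * _); rewrite -invrM //; apply: (canLR (mulKr (uf n))).
apply: (canRL (mulrK _)); first by rewrite unitrM !uf.
by rewrite -!natrM [(_`! * _)%N]mulnC bin_fact.
Qed.

(** What turns the sum over [l] into the binomial expansion of
    (e^t - lambda)^r. *)
Lemma fps_exp_linear_nat l :
  fps_exp ((l%:R : A)%:S * fpsX) = fps_exp fpsX ^+ l.
Proof.
elim: l => [|l IH].
  apply/fpsP => n; rewrite coef_fps_exp_linear expr0 fps1E expr0n.
  by case: n => [|n]; rewrite ?mulr0 // fact0 invr1 mulr1.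
by rewrite -natr1 addrC fps_exp_linearD IH exprS rmorph1 mul1r.
Qed.

End ExpLinear.

Lemma egf_coefM (A : comUnitRingType) (f g : fps A) n :
  egf_coef (f * g) n =
    \sum_(m < n.+1) 'C(n, m)%:R * (egf_coef f m * egf_coef g (n - m)).
Proof.
rewrite /egf_coef fpsME mulr_sumr; apply: eq_bigr => m _.
have le_mn : (m <= n)%N by rewrite -ltnS.
by rewrite -(bin_fact le_mn) !natrM -mulrA [in RHS]mulrACA.
Qed.

Lemma egf_coef_map (A B : comUnitRingType) (f : {rmorphism A -> B}) g n :
  egf_coef (fps_map f g) n = f (egf_coef g n).
Proof. by rewrite /egf_coef rmorphM rmorph_nat. Qed.

Lemma egf_coef_sum (A : comUnitRingType) N (F : 'I_N -> fps A) n :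
  egf_coef (\sum_(i < N) F i) n = \sum_(i < N) egf_coef (F i) n.
Proof. by rewrite /egf_coef fps_sumE mulr_sumr. Qed.

(** * The generating functions *)

Section GeneratingFunctions.
Variable R : realType.
Local Notation C := R[i].
Local Notation t := (fpsX : fps {poly C}).

(** The substitution of [c] for ['X] is taken as an endomorphism of [{poly C}],
    not as evaluation into [C], so that the values remain in the ring where the
    generating functions live. *)
Local Notation subst c := (comp_poly (c%:P : {poly C})).

(** The factors other than e^(x t) are fixed, as [c] replaces ['X] only there. *)
Lemma hermite_poly_bernoulli_gf_subst (nu : R) k (c : C) :
  fps_map (subst c) (hermite_poly_bernoulli_gf nu k) =
    fps_exp ((- (nu%:C%C / 2))%:P%:S * t ^+ 2) * poly_bernoulli_quot R k *
      fps_exp (c%:P%:S * t).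
Proof.
rewrite /hermite_poly_bernoulli_gf [LHS]fps_map_polylog_gf.
  by rewrite [_ _%:P]comp_polyC [_ 'X]comp_polyX.
exact: nat_units_poly.
Qed.

(** Multiplying by P (e^t - lambda)^r, which is what the sum over [l] amounts to,
    cancels the denominator of the Frobenius-Euler series. *)
Lemma hermite_poly_bernoulli_gf_expand (nu : R) k (lambda : C) r :
    lambda != 1 ->
  ((1 - lambda) ^+ r)%:P%:S * hermite_poly_bernoulli_gf nu k =
    frobenius_euler_gf r lambda *
      \sum_(l < r.+1) ('C(r, l)%:R * (- lambda) ^+ (r - l))%:P%:S *
        fps_map (subst l%:R) (hermite_poly_bernoulli_gf nu k).
Proof.
move=> lambda_neq1; have uden := frobenius_euler_den_unit lambda_neq1.
pose P := fps_exp ((- (nu%:C%C / 2))%:P%:S * t ^+ 2) * poly_bernoulli_quot R k.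
have -> : \sum_(l < r.+1) ('C(r, l)%:R * (- lambda) ^+ (r - l))%:P%:S *
    fps_map (subst l%:R) (hermite_poly_bernoulli_gf nu k) =
    P * (fps_exp t - lambda%:P%:S) ^+ r.
  rewrite addrC exprDn mulr_sumr; apply: eq_bigr => l _.
  rewrite hermite_poly_bernoulli_gf_subst -/P polyC_natr.
  rewrite fps_exp_linear_nat; last exact: nat_units_poly.
  by rewrite !rmorphM !rmorph_nat !rmorphXn !rmorphN /= mulrCA -!mulrA mulr_natl.
(* Over an abstract ring the operations cannot unfold to the finite sums that
   define them on [fps {poly C}]. *)
have cancel (S : comUnitRingType) (a d p e : S) : d \is a GRing.unit ->
    a ^+ r * (p * e) = (a / d) ^+ r * e * (p * d ^+ r).
  move=> ud; rewrite expr_div_n [p * _ in RHS]mulrC [RHS]mulrACA.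
  by rewrite divrK ?unitrX // (mulrC p).
by rewrite [LHS](_ : _ = (1 - lambda)%:P%:S ^+ r * (P * fps_exp ('X%:S * t)));
  [exact: cancel | rewrite !rmorphXn].
Qed.

End GeneratingFunctions.

Theorem theorem11 (R : realType) (k : int) (nu : R) (nu_neq0 : nu != 0)
    (lambda : R[i]) (lambda_neq1 : lambda != 1) (n r : nat) :
  hermite_poly_bernoulli nu k n =
    ((1 - lambda) ^+ r)^-1 *:
      \sum_(m < n.+1) 'C(n, m)%:R *:
        ((\sum_(l < r.+1) 'C(r, l)%:R * (- lambda) ^+ (r - l) *
            (hermite_poly_bernoulli nu k (n - m)).[l%:R]) *:
         frobenius_euler r lambda m).
Proof.
have cr_neq0 : (1 - lambda) ^+ r != 0.
  by rewrite expf_neq0 // subr_eq0 eq_sym.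
apply: (canRL (scalerK cr_neq0)).
have egf_coefC c f m : egf_coef (c%:P%:S * f) m = c *: egf_coef f m :> {poly R[i]}.
  by rewrite /egf_coef fpsCM mulrCA mul_polyC.
rewrite /hermite_poly_bernoulli -egf_coefC hermite_poly_bernoulli_gf_expand //.
rewrite egf_coefM; apply: eq_bigr => m _.
rewrite -polyC_natr mul_polyC; congr (_ *: _).
(* The value at [l] reappears as a constant polynomial, so scaling by it is
   multiplication. *)
rewrite [LHS]mulrC -[RHS]mul_polyC; congr (_ * _).
rewrite egf_coef_sum rmorph_sum; apply: eq_bigr => l _.
by rewrite egf_coefC egf_coef_map /= comp_polyCr polyCM mul_polyC.
Qed.
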